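(* The $q$-difference equation $$\frac{\prod_{j=1}^8(x-q^{1/2}v_j)}{q\,x^2(x^2-1)(x^2-q)}u(x/q)+\frac{\prod_{j=1}^8(q^{1/2}v_jx-1)}{q\,x^2(x^2-1)(qx^2-1)}u(qx)+\tilde B^0(x)u(x)=E\,u(x),$$ where $$\tilde B^0(x)=\frac{-q^{1/2}x}{2(x-q^{-1/2})(x-q^{1/2})}\prod_{j=1}^8(1-v_j)+\frac{q^{1/2}x}{2(x+q^{-1/2})(x+q^{1/2})}\prod_{j=1}^8(1+v_j)-(v_1v_2\cdots v_8)^{1/2}\Bigl[(q+1)\Bigl(x^2+\frac1{x^2}\Bigr)-q^{1/2}\Bigl(x+\frac1x\Bigr)\sum_{j=1}^8\Bigl(v_j+\frac1{v_j}\Bigr)\Bigr],$$ which was obtained from the associated linear equation of the $q$-Painlevé equation of type $E_8^{(1)}$, is equivalent to the equation $$\tilde A^{\langle1\rangle}(h;z)f(z)=E f(z),$$ where $\tilde A^{\langle1\rangle}(h;z)$ is the firstly degenerated Ruijsenaars–van Diejen operator and $E$ is an arbitrary complex number. The correspondence is $x=e^{2\pi iz}$, $q=e^{-2\pi a_-}$, $v_n=e^{2\pi i\tilde h_n}$ $(n=1,\dots,8)$, $f(z)=u(e^{2\pi iz})$.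
   Context: The operator $\exp(\pm ia_-\partial_z)$ acts by $\exp(\pm ia_-\partial_z)f(z)=f(z\pm ia_-)$. The firstly degenerated Ruijsenaars–van Diejen operator, with parameters $a_-$ and $\tilde h_1,\dots,\tilde h_8$, is $$\tilde A^{\langle1\rangle}(h;z)=\tilde V^{\langle1\rangle}(h;z)\exp(-ia_-\partial_z)+\tilde W^{\langle1\rangle}(h;z)\exp(ia_-\partial_z)+U^{\langle1\rangle}(h;z),$$ $$\tilde V^{\langle1\rangle}(h;z)=\frac{\prod_{n=1}^8(1-e^{-2\pi iz}e^{2\pi i\tilde h_n}e^{-\pi a_-})}{e^{-2\pi a_-}e^{-4\pi iz}(1-e^{-4\pi iz})(1-e^{-4\pi iz}e^{-2\pi a_-})},\qquad \tilde W^{\langle1\rangle}(h;z)=\frac{\prod_{n=1}^8(1-e^{2\pi iz}e^{2\pi i\tilde h_n}e^{-\pi a_-})}{e^{-2\pi a_-}e^{4\pi iz}(1-e^{4\pi iz})(1-e^{4\pi iz}e^{-2\pi a_-})},$$ $$U^{\langle1\rangle}(h;z)=\frac{\prod_{n=1}^8(e^{2\pi i\tilde h_n}-1)}{2(1-e^{2\pi iz}e^{\pi a_-})(1-e^{-2\pi iz}e^{\pi a_-})}+\frac{\prod_{n=1}^8(e^{2\pi i\tilde h_n}+1)}{2(1+e^{2\pi iz}e^{\pi a_-})(1+e^{-2\pi iz}e^{\pi a_-})}$$ $$+e^{-\pi a_-}\prod_{n=1}^8e^{\pi i\tilde h_n}\cdot\Bigl[(e^{2\pi iz}+e^{-2\pi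 iz})\sum_{n=1}^8(e^{2\pi i\tilde h_n}+e^{-2\pi i\tilde h_n})-(e^{\pi a_-}+e^{-\pi a_-})(e^{4\pi iz}+e^{-4\pi iz})\Bigr].$$ Square roots: $q^{1/2}=e^{-\pi a_-}$ and $(v_1\cdots v_8)^{1/2}=\prod_{n=1}^8e^{\pi i\tilde h_n}$. Provenance of the first equation: it is the rewriting, by $z=(qh_1)^{1/2}x$, $\tilde y(z)=u(x)$, $u_1=q^{-1}h_1^{1/2}v_1$, $u_j=h_1^{1/2}v_j$ $(2\le j\le8)$, of the limit (as the Painlevé variables $(f,g)$ tend to the point $(u_1+h_1/u_1,\,u_1+h_2/u_1)$) of the linear equation $L_1y=0$ in Yamada's Lax pair for the $q$-Painlevé equation of type $E_8^{(1)}$ with parameters $h_1,h_2,u_1,\dots,u_8$; this provenance is not needed for the equivalence. *)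

(* Defs.v *)
From HB Require Import structures.
From mathcomp Require Import all_boot all_order all_algebra.
From mathcomp Require Import classical_sets reals sequences exp trigo.
From mathcomp Require Export complex.

Set Implicit Arguments.
Unset Strict Implicit.
Unset Printing Implicit Defensive.

Import Order.TTheory GRing.Theory Num.Theory.
Local Open Scope ring_scope.
Local Open Scope complex_scope.

Definition expC (R : realType) (z : R[i]) : R[i] :=
  (expR (complex.Re z))%:C * (cos (complex.Im z) +i* sin (complex.Im z)).

Definition iC (R : realType) : R[i] := 0 +i* 1.

Definition piC (R : realType) : R[i] := (pi : R)%:C.

Section RuijsenaarsVanDiejen.
Variables (R : realType) (a : R[i]) (h : 'I_8 -> R[i]).
Local Notation C := R[i].
Local Notation e := (@expC R).
Local Notation π := (@piC R).
Local Notation ii := (@iC R).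

(* [shift c f] is exp(c ∂_z) f. *)
Definition shift (c : C) (f : C -> C) : C -> C := fun z => f (z + c).

Definition RvD_V_den (z : C) : C :=
  e (- 2 * π * a) * e (- 4 * π * ii * z) * (1 - e (- 4 * π * ii * z))
  * (1 - e (- 4 * π * ii * z) * e (- 2 * π * a)).

Definition RvD_V (z : C) : C :=
  (\prod_(n < 8)
     (1 - e (- 2 * π * ii * z) * e (2 * π * ii * h n) * e (- π * a)))
  / RvD_V_den z.

Definition RvD_W_den (z : C) : C :=
  e (- 2 * π * a) * e (4 * π * ii * z) * (1 - e (4 * π * ii * z))
  * (1 - e (4 * π * ii * z) * e (- 2 * π * a)).

Definition RvD_W (z : C) : C :=
  (\prod_(n < 8)
     (1 - e (2 * π * ii * z) * e (2 * π * ii * h n) * e (- π * a)))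
  / RvD_W_den z.

Definition RvD_U_den1 (z : C) : C :=
  2 * (1 - e (2 * π * ii * z) * e (π * a))
    * (1 - e (- 2 * π * ii * z) * e (π * a)).

Definition RvD_U_den2 (z : C) : C :=
  2 * (1 + e (2 * π * ii * z) * e (π * a))
    * (1 + e (- 2 * π * ii * z) * e (π * a)).

Definition RvD_U (z : C) : C :=
  (\prod_(n < 8) (e (2 * π * ii * h n) - 1)) / RvD_U_den1 z
  + (\prod_(n < 8) (e (2 * π * ii * h n) + 1)) / RvD_U_den2 z
  + e (- π * a) * (\prod_(n < 8) e (π * ii * h n))
    * ((e (2 * π * ii * z) + e (- 2 * π * ii * z))
         * (\sum_(n < 8) (e (2 * π * ii * h n) + e (- 2 * π * ii * h n)))
       - (e (π * a) + e (- π * a))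
         * (e (4 * π * ii * z) + e (- 4 * π * ii * z))).

Definition RvD_operator (f : C -> C) : C -> C := fun z =>
  RvD_V z * shift (- (ii * a)) f z + RvD_W z * shift (ii * a) f z
  + RvD_U z * f z.

(* The coefficients of the operator have poles, whereas division is total
   here, so the eigenvalue equation is imposed only off the poles. *)
Definition RvD_regular (z : C) : Prop :=
  [/\ RvD_V_den z != 0, RvD_W_den z != 0, RvD_U_den1 z != 0
    & RvD_U_den2 z != 0].

Definition RvD_equation_at (E : C) (f : C -> C) (z : C) : Prop :=
  RvD_regular z -> RvD_operator f z = E * f z.

End RuijsenaarsVanDiejen.

Section QDifferenceEquation.
(* [qh] stands for q^(1/2) and [vh] for (v_1 ... v_8)^(1/2). *)
Variables (F : fieldType) (q qh : F) (v : 'I_8 -> F) (vh : F).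

Definition qdiff_den_down (x : F) : F :=
  q * x ^+ 2 * (x ^+ 2 - 1) * (x ^+ 2 - q).

Definition qdiff_den_up (x : F) : F :=
  q * x ^+ 2 * (x ^+ 2 - 1) * (q * x ^+ 2 - 1).

Definition qdiff_B0_den1 (x : F) : F := 2 * (x - qh^-1) * (x - qh).

Definition qdiff_B0_den2 (x : F) : F := 2 * (x + qh^-1) * (x + qh).

Definition qdiff_B0 (x : F) : F :=
  - qh * x / qdiff_B0_den1 x * (\prod_(j < 8) (1 - v j))
  + qh * x / qdiff_B0_den2 x * (\prod_(j < 8) (1 + v j))
  - vh * ((q + 1) * (x ^+ 2 + 1 / x ^+ 2)
          - qh * (x + 1 / x) * (\sum_(j < 8) (v j + 1 / v j))).

Definition qdiff_operator (u : F -> F) : F -> F := fun x =>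
  (\prod_(j < 8) (x - qh * v j)) / qdiff_den_down x * u (x / q)
  + (\prod_(j < 8) (qh * v j * x - 1)) / qdiff_den_up x * u (q * x)
  + qdiff_B0 x * u x.

Definition qdiff_regular (x : F) : Prop :=
  x != 0 /\ [/\ qdiff_den_down x != 0, qdiff_den_up x != 0,
    qdiff_B0_den1 x != 0 & qdiff_B0_den2 x != 0].

Definition qdiff_equation_at (E : F) (u : F -> F) (x : F) : Prop :=
  qdiff_regular x -> qdiff_operator u x = E * u x.

End QDifferenceEquation.

(* Main.v *)
Require Import Defs.
From mathcomp Require Import all_boot all_order all_algebra.
From mathcomp Require Import classical_sets reals sequences exp trigo.
From mathcomp Require Import boolp ring lra.

(** Under x = e^(2πiz) every denominator of the operator is a nonzero monomial
    in x and q^(1/2) times the corresponding denominator of the q-difference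
    equation, and the numerators differ by the same monomials.  Hence the two
    operators agree at z and x and have the same poles.  The converse direction
    also uses that z ↦ e^(2πiz) is onto the nonzero complex numbers; x = 0 is
    excluded because it is a pole of the q-difference equation. *)

Import Order.TTheory GRing.Theory Num.Theory.
Local Open Scope ring_scope.
Local Open Scope complex_scope.

Section ComplexExponential.
Variable R : realType.
Implicit Types z w : R[i].

Lemma expC0 : expC 0 = 1 :> R[i].
Proof. by rewrite /expC /= expR0 cos0 sin0 mul1r. Qed.

Lemma expCD z w : expC (z + w) = expC z * expC w.
Proof.
case: z w => [z1 z2] [w1 w2]; rewrite /expC /= expRD cosD sinD.
by apply/eqP; rewrite eq_complex /=; apply/andP; split; apply/eqP; ring.
Qed.

Lemma expC_neq0 z : expC z != 0.
Proof.
apply/eqP => z0; have /eqP := expCD z (- z).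
by rewrite subrr expC0 z0 mul0r oner_eq0.
Qed.

Lemma expCN z : expC (- z) = (expC z)^-1.
Proof.
apply: (mulfI (expC_neq0 z)).
by rewrite -expCD subrr expC0 divff ?expC_neq0.
Qed.

Lemma expCMn z n : expC (z *+ n) = expC z ^+ n.
Proof.
elim: n => [|n IH]; first by rewrite mulr0n expC0 expr0.
by rewrite mulrS expCD IH exprS.
Qed.

(** [acos c] has cosine [c] and sine [|s|], since arccosine takes values in [0, π]; for negative [s]
    its opposite corrects the sign of the sine. *)
Lemma cos_sin_onto (c s : R) :
  c ^+ 2 + s ^+ 2 = 1 -> exists t, cos t = c /\ sin t = s.
Proof.
move=> cs1.
have c11 : -1 <= c <= 1.
  by have s2 := sqr_ge0 s; apply/andP; split; nra.
have sinE : sin (acos c) = `|s|.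
  by rewrite sin_acos // -cs1 addrC addKr sqrtr_sqr.
have [s0|s0] := leP 0 s.
  by exists (acos c); rewrite acosK // sinE ger0_norm.
by exists (- acos c); rewrite cosN sinN acosK // sinE ltr0_norm // opprK.
Qed.

(** Polar form: the preimage is the logarithm of the modulus [r] plus [i] times an angle of the
    normalised point. *)
Lemma expC_onto w : w != 0 -> exists z, expC z = w.
Proof.
case: w => [c s] w0.
have n0 : 0 < c ^+ 2 + s ^+ 2.
  rewrite lt_neqAle addr_ge0 ?sqr_ge0 // andbT eq_sym paddr_eq0 ?sqr_ge0 //.
  by move: w0; rewrite eq_complex /= !sqrf_eq0.
pose r := Num.sqrt (c ^+ 2 + s ^+ 2).
have r0 : 0 < r by rewrite sqrtr_gt0.
have r2 : r ^+ 2 = c ^+ 2 + s ^+ 2 by rewrite sqr_sqrtr // ltW.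
have [t [ct st]] : exists t, cos t = c / r /\ sin t = s / r.
  apply: cos_sin_onto; rewrite !expr_div_n -mulrDl r2 divff ?gt_eqF //.
exists (ln r +i* t); rewrite /expC /= lnK ?posrE // ct st.
apply/eqP; rewrite eq_complex /=; apply/andP; split; apply/eqP.
  by field; rewrite gt_eqF.
by field; rewrite gt_eqF.
Qed.

(** Lets a preimage under [expC] be rescaled to a preimage under z ↦ e^(2πiz). *)
Lemma two_piC_neq0 : 2 * piC R * iC R != 0.
Proof.
rewrite !mulf_neq0 ?pnatr_eq0 // eq_complex /= ?eqxx ?oner_eq0 ?andbF //.
by rewrite gt_eqF ?pi_gt0.
Qed.

End ComplexExponential.

Section Correspondence.
Variables (R : realType) (a : R[i]) (h : 'I_8 -> R[i]).
Local Notation e := (@expC R).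
Local Notation π := (@piC R).
Local Notation ii := (@iC R).
Variable z : R[i].

Let x := e (2 * π * ii * z).
Let qh := e (- π * a).
Let q := e (- 2 * π * a).
Let v n := e (2 * π * ii * h n).
Let vh := \prod_(n < 8) e (π * ii * h n).

Let x0 : x != 0. Proof. exact: expC_neq0. Qed.
Let qh0 : qh != 0. Proof. exact: expC_neq0. Qed.

Let qE : q = qh ^+ 2.
Proof. by rewrite -expCMn; congr expC; ring. Qed.

Let expxV : e (- 2 * π * ii * z) = x^-1.
Proof. by rewrite -expCN; congr expC; ring. Qed.

Let expx2 : e (4 * π * ii * z) = x ^+ 2.
Proof. by rewrite -expCMn; congr expC; ring. Qed.

Let expxV2 : e (- 4 * π * ii * z) = x ^- 2.
Proof. by rewrite -expCMn -expCN; congr expC; ring. Qed.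

Let expqV : e (π * a) = qh^-1.
Proof. by rewrite -expCN; congr expC; ring. Qed.

Let expvV n : e (- 2 * π * ii * h n) = (v n)^-1.
Proof. by rewrite -expCN; congr expC; ring. Qed.

Let expE := (expxV, expx2, expxV2, expqV).

(** The leading monomials [x ^- 2] and [x ^ 2] differ by [x ^- 4], and each of the two binomials
    contributes a further [x ^- 2]. *)
Lemma RvD_V_denE : RvD_V_den a z = x ^- 8 * qdiff_den_down q x.
Proof.
rewrite /RvD_V_den /qdiff_den_down !expE -/q; field; exact: x0.
Qed.

Lemma RvD_W_denE : RvD_W_den a z = qdiff_den_up q x.
Proof. by rewrite /RvD_W_den /qdiff_den_up !expE -/q; ring. Qed.

Lemma RvD_U_den1E : RvD_U_den1 a z = - (qh * x)^-1 * qdiff_B0_den1 qh x.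
Proof.
by rewrite /RvD_U_den1 /qdiff_B0_den1 !expE -/x; field; rewrite qh0 x0.
Qed.

Lemma RvD_U_den2E : RvD_U_den2 a z = (qh * x)^-1 * qdiff_B0_den2 qh x.
Proof.
by rewrite /RvD_U_den2 /qdiff_B0_den2 !expE -/x; field; rewrite qh0 x0.
Qed.

(** Matching denominators differ by nonzero factors, so they vanish together; [x != 0] is automatic
    for an exponential. *)
Lemma RvD_regularE : RvD_regular a z <-> qdiff_regular q qh x.
Proof.
rewrite /RvD_regular /qdiff_regular RvD_V_denE RvD_W_denE RvD_U_den1E.
have x8 : x ^- 8 != 0 by rewrite invr_eq0 expf_neq0.
have qhx : (qh * x)^-1 != 0 by rewrite invr_eq0 mulf_neq0.
have qhxN : - (qh * x)^-1 != 0 by rewrite oppr_eq0.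
rewrite RvD_U_den2E (mulrI_eq0 _ (mulfI x8)) (mulrI_eq0 _ (mulfI qhxN)).
by rewrite (mulrI_eq0 _ (mulfI qhx)); split=> [|[]].
Qed.

Lemma RvD_VE :
  RvD_V a h z = (\prod_(j < 8) (x - qh * v j)) / qdiff_den_down q x.
Proof.
rewrite /RvD_V RvD_V_denE expxV.
(* Each of the eight factors releases one [x^-1]; together they cancel the [x ^- 8] of the
   denominator. *)
have -> : \prod_(n < 8) (1 - x^-1 * v n * qh) =
    x ^- 8 * \prod_(n < 8) (x - qh * v n).
  rewrite -exprVn -[in x^-1 ^+ 8](card_ord 8) -prodr_const -big_split /=.
  by apply: eq_bigr => n _; field.
by rewrite -mulf_div divff ?mul1r // invr_eq0 expf_eq0.
Qed.

Lemma RvD_WE :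
  RvD_W a h z = (\prod_(j < 8) (qh * v j * x - 1)) / qdiff_den_up q x.
Proof.
rewrite /RvD_W RvD_W_denE -/x; congr (_ / _).
(* Negating all factors is harmless because their number, 8, is even. *)
under eq_bigr => n _ do rewrite -opprB.
rewrite prodrN card_ord -signr_odd mul1r.
by apply: eq_bigr => n _; rewrite -/(v n) -/qh; ring.
Qed.

Lemma RvD_UE : RvD_U a h z = qdiff_B0 q qh v vh x.
Proof.
rewrite /RvD_U /qdiff_B0 RvD_U_den1E RvD_U_den2E !expE -/x -/qh -/vh.
have -> : \prod_(n < 8) (v n - 1) = \prod_(n < 8) (1 - v n).
  under eq_bigr => n _ do rewrite -opprB.
  by rewrite prodrN card_ord -signr_odd mul1r.
have -> : \prod_(n < 8) (v n + 1) = \prod_(n < 8) (1 + v n).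
  by apply: eq_bigr => n _; rewrite addrC.
have -> : \sum_(n < 8) (v n + e (- 2 * π * ii * h n)) =
    \sum_(n < 8) (v n + 1 / v n).
  by apply: eq_bigr => n _; rewrite expvV div1r.
congr (_ + _ + _).
- by rewrite invfM invrN invrK mulrC [in RHS]mulNr.
- by rewrite invfM invrK mulrC.
(* The brackets agree because [qh * (qh^-1 + qh) = q + 1], which rests on [q = qh ^+ 2]. *)
rewrite qE; field; rewrite x0; exact: qh0.
Qed.

Lemma RvD_operatorE (u f : R[i] -> R[i]) :
  (forall z, f z = u (e (2 * π * ii * z))) ->
  RvD_operator a h f z = qdiff_operator q qh v vh u x.
Proof.
move=> fE; rewrite /RvD_operator /qdiff_operator RvD_VE RvD_WE RvD_UE.
have ii2 : ii * ii = -1.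
  by apply/eqP; rewrite eq_complex /=; apply/andP; split; apply/eqP; ring.
(* Since 2πi · (∓ia) = ±2πa, the additive shifts of [z] become multiplication of [x] by [q^-1] and
   [q]. *)
have xdown : e (2 * π * ii * (z - ii * a)) = x / q.
  rewrite mulrBr expCD; congr (_ * _); rewrite -expCN; congr expC.
  by rewrite -!mulrA (mulrA ii) ii2; ring.
have xup : e (2 * π * ii * (z + ii * a)) = q * x.
  rewrite mulrDr expCD mulrC; congr (_ * _); congr expC.
  by rewrite -!mulrA (mulrA ii) ii2; ring.
by rewrite /shift !fE xdown xup.
Qed.

End Correspondence.

Theorem theorem3p2 (R : realType)
    (a : R[i]) (h : 'I_8 -> R[i])
    (q qh : R[i]) (v : 'I_8 -> R[i]) (vh : R[i])
    (u f : R[i] -> R[i]) (E : R[i]) (D : set R[i])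
    (q_def : q = expC (- 2 * piC R * a))
    (qh_def : qh = expC (- piC R * a))
    (v_def : forall n, v n = expC (2 * piC R * iC R * h n))
    (vh_def : vh = \prod_(n < 8) expC (piC R * iC R * h n))
    (f_def : forall z, f z = u (expC (2 * piC R * iC R * z))) :
  (forall x : R[i], D x -> qdiff_equation_at q qh v vh E u x)
  <->
  (forall z : R[i], D (expC (2 * piC R * iC R * z)) -> RvD_equation_at a h E f z).
Proof.
(* An equality of functions, unlike the pointwise [v_def], allows [v] to be substituted. *)
have vE : v = fun n => expC (2 * piC R * iC R * h n) by apply/funext.
subst q qh v vh.
split=> [eqx z Dz /RvD_regularE zreg | eqz x Dx xreg].
  by rewrite (RvD_operatorE R a h _ u f f_def) f_def; apply: eqx.
have [w ew] := expC_onto R x xreg.1.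
have zE : expC (2 * piC R * iC R * (w / (2 * piC R * iC R))) = x.
  by rewrite mulrC divfK ?two_piC_neq0 ?ew.
rewrite -zE -(RvD_operatorE R a h _ u f f_def) -f_def; apply: eqz; rewrite ?zE //.
by apply/RvD_regularE; rewrite zE.
Qed.
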